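(* Let $\mathbf H_1=(\mathbf G_1,F_1)$ and $\mathbf H_2=(\mathbf G_2,F_2)$ be $F$-sup-semilattices, $f\colon\mathbf H_1\to\mathbf H_2$ a lax morphism of $F$-sup-semilattices and $\mathbf J=(T,S)$ a frame. Then there is a unique morphism of sup-semilattices $\mathbf J\otimes f\colon\mathbf J\otimes\mathbf H_1\to\mathbf J\otimes\mathbf H_2$ such that $$(\mathbf J\otimes f)\circ\mathrm n(j[\mathbf J,\mathbf H_1])=\mathrm n(j[\mathbf J,\mathbf H_2])\circ f^{\mathbf J},$$ where $f^{\mathbf J}\colon\mathbf G_1^T\to\mathbf G_2^T$ is given by $(f^{\mathbf J}(x))(i)=f(x(i))$. Moreover, $\mathbf J\otimes-$ (sending $\mathbf H$ to $\mathbf J\otimes\mathbf H$ and $f$ to $\mathbf J\otimes f$) is a functor from the category of $F$-sup-semilattices and lax morphisms to the category of sup-semilattices.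
   Context: A sup-semilattice is a poset in which every subset has a join (bottom element $0$); morphisms of sup-semilattices are maps preserving arbitrary joins. An $F$-sup-semilattice is a pair $(\mathbf G,F)$ where $\mathbf G$ is a sup-semilattice and $F\colon G\to G$ preserves arbitrary joins. A lax morphism of $F$-sup-semilattices $(\mathbf G_1,F_1)\to(\mathbf G_2,F_2)$ is a sup-semilattice morphism $f$ with $F_2(f(x))\leq f(F_1(x))$ for all $x\in G_1$. A frame $\mathbf J=(T,S)$ is a set $T$ with a binary relation $S\subseteq T^2$. Construction of $\mathbf J\otimes\mathbf H$ for a frame $\mathbf J=(T,S)$ and an $F$-sup-semilattice $\mathbf H=(\mathbf G,F)$. Let $\mathbf G^T$ be the set of maps $T\to G$ with pointwise order. For $x\in G$, $i\in T$ let $x_{iS}\in G^T$ be given by $x_{iS}(k)=x$ if $(i,k)\in S$ and $x_{iS}(k)=0$ otherwise; let $x_{i=}\in G^T$ be given by $x_{i=}(i)=x$ and $x_{i=}(k)=0$ for $k\neq i$. Put $[\mathbf J,\mathbf H]=\{(x_{iS}\vee F(x)_{i=},\,F(x)_{i=})\mid x\in G,\ i\in T\}\subseteq (G^T)^2$. Define $j=j[\mathbf J,\mathbf H]\colon G^T\to G^T$ by $$j(a)=a\vee\bigvee\{c\in G^T\mid \text{there is } d\leq a \text{ with } (c,d)\in[\mathbf J,\mathbf H]\text{ or }(d,c)\in[\mathbf J,\mathbf H]\}.$$ Then $\mathbf J\otimes\mathbf H$ is the set $\{a\in G^T\mid j(a)=a\}$ of fixed points of $j$ with the order inherited from $\mathbf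 G^T$; and $\mathrm n(j)\colon G^T\to\mathbf J\otimes\mathbf H$ is the associated closure operator $\mathrm n(j)(a)=\bigwedge\{x\in G^T\mid j(x)=x,\ a\leq x\}$. $\mathbf J\otimes\mathbf H$ is a sup-semilattice whose join of a subset $M$ is $\mathrm n(j)(\bigvee M)$ with $\bigvee M$ computed in $\mathbf G^T$. *)

(* Defs.v *)
From HB Require Import structures.
From mathcomp Require Import all_boot all_order all_classical.

Set Implicit Arguments.
Unset Strict Implicit.
Unset Printing Implicit Defensive.

Import Order.TTheory.
Local Open Scope classical_set_scope.
Local Open Scope order_scope.

(* The join is carried as data; by antisymmetry it is determined by the order,
   so this is the same as asking that every subset has a supremum. *)
HB.mixin Record isSupSemilattice (d : Order.disp_t) T of Order.POrder d T := {
  sjoin : set T -> T;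
  sjoinP : forall A : set T, supremums A (sjoin A)
}.

#[short(type="supSemilatticeType")]
HB.structure Definition SupSemilattice (d : Order.disp_t) :=
  { T of isSupSemilattice d T & Order.POrder d T }.

Section SupSemilatticeOps.
Context {d : Order.disp_t} {G : supSemilatticeType d}.
Implicit Types (A : set G) (a b : G).

Definition sbot : G := sjoin set0.
Definition sjoin2 a b : G := sjoin [set a; b].
Definition smeet A : G := sjoin (lbound A).

Lemma sjoin_ub A a : A a -> a <= sjoin A.
Proof. by case: (sjoinP A) => + _; apply. Qed.

Lemma sjoin_le A b : (forall a, A a -> a <= b) -> sjoin A <= b.
Proof. by case: (sjoinP A) => _; apply. Qed.

Lemma smeet_lb A a : A a -> smeet A <= a.
Proof. by move=> Aa; apply: sjoin_le => b; apply. Qed.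

Lemma smeet_ge A b : (forall a, A a -> b <= a) -> b <= smeet A.
Proof. by move=> bA; apply: sjoin_ub => a; apply: bA. Qed.

End SupSemilatticeOps.

Section FunSupSemilattice.
Context (T : Type) (d : Order.disp_t) (G : supSemilatticeType d).

Definition fun_sjoin (A : set (T -> G)) : T -> G :=
  fun i => sjoin [set a i | a in A].

Lemma fun_sjoinP (A : set (T -> G)) : supremums A (fun_sjoin A).
Proof.
split=> [a Aa|b bA]; apply/lefP => i.
  by apply: sjoin_ub; exists a.
by apply: sjoin_le => _ [a Aa <-]; exact: (lefP _ _ (bA a Aa)).
Qed.

HB.instance Definition _ := isSupSemilattice.Build _ (T -> G) fun_sjoinP.

End FunSupSemilattice.

Record suphom (d1 d2 : Order.disp_t)
    (G : supSemilatticeType d1) (K : supSemilatticeType d2) := Suphom {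
  suphom_fun :> G -> K;
  suphomP : forall A : set G,
    suphom_fun (sjoin A) = sjoin [set suphom_fun x | x in A]
}.

Record fsup (d : Order.disp_t) := Fsup {
  fsup_sort :> supSemilatticeType d;
  fop : suphom fsup_sort fsup_sort
}.

Record laxhom (d : Order.disp_t) (H1 H2 : fsup d) := Laxhom {
  laxhom_sup :> suphom H1 H2;
  laxhomP : forall x : H1, fop H2 (laxhom_sup x) <= laxhom_sup (fop H1 x)
}.

Record frame := Frame {
  frame_sort :> Type;
  frame_rel : frame_sort -> frame_sort -> Prop
}.

Section Tensor.
Context (d : Order.disp_t) (J : frame) (H : fsup d).
Implicit Types a b c : J -> H.

Definition at_rel (x : H) (i : J) : J -> H :=
  fun k => if `[< frame_rel i k >] then x else sbot.

Definition at_eq (x : H) (i : J) : J -> H :=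
  fun k => if `[< k = i >] then x else sbot.

Definition tensor_rel : set ((J -> H) * (J -> H)) :=
  [set p | exists x i,
     p = (sjoin2 (at_rel x i) (at_eq (fop H x) i), at_eq (fop H x) i)].

Definition jmap a : J -> H :=
  sjoin2 a (sjoin [set c | exists2 b, b <= a &
                           tensor_rel (c, b) \/ tensor_rel (b, c)]).

Definition jclosure a : J -> H := smeet [set x | jmap x = x /\ a <= x].

Lemma le_jmap a : a <= jmap a.
Proof. by apply: sjoin_ub; left. Qed.

Lemma jmap_homo a b : a <= b -> jmap a <= jmap b.
Proof.
move=> ab; apply: sjoin_le => _ [->|->].
  exact: le_trans ab (le_jmap b).
apply: sjoin_le => c [e ea ce].
apply: (@le_trans _ _ (sjoin [set c | exists2 b', b' <= b &
                           tensor_rel (c, b') \/ tensor_rel (b', c)])).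
  by apply: sjoin_ub; exists e => //; exact: le_trans ab.
by apply: sjoin_ub; right.
Qed.

Lemma jclosure_fixed a : jmap (jclosure a) == jclosure a.
Proof.
rewrite eq_le le_jmap andbT; apply: smeet_ge => x [jx ax].
by rewrite -jx; apply: jmap_homo; apply: smeet_lb.
Qed.

Record tensor := Tensor { tensor_val :> J -> H; _ : jmap tensor_val == tensor_val }.

HB.instance Definition _ := [isSub for tensor_val].
HB.instance Definition _ := [Choice of tensor by <:].
HB.instance Definition _ := [SubChoice_isSubPOrder of tensor by <: with d].

(* jclosure corestricted to its image, the fixed points of jmap. *)
Definition nj a : tensor := Tensor (jclosure_fixed a).

Definition tensor_sjoin (M : set tensor) : tensor :=
  nj (sjoin [set tensor_val t | t in M]).

Lemma tensor_sjoinP (M : set tensor) : supremums M (tensor_sjoin M).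
Proof.
split=> [t Mt|u uM]; rewrite -Order.le_val /=.
  apply: smeet_ge => x [_]; apply: le_trans.
  by apply: sjoin_ub; exists t.
apply: smeet_lb; split; first by apply/eqP; case: (u).
by apply: sjoin_le => _ [t Mt <-]; have := uM t Mt; rewrite -Order.le_val.
Qed.

HB.instance Definition _ := isSupSemilattice.Build d tensor tensor_sjoinP.

End Tensor.
Arguments nj {d} J H a.

Definition pointwise (T : Type) (d : Order.disp_t)
    (G1 G2 : supSemilatticeType d) (f : suphom G1 G2) (x : T -> G1) : T -> G2 :=
  fun i => f (x i).
Arguments pointwise T {d G1 G2} f x.

Definition tensor_square (d : Order.disp_t) (J : frame) (H1 H2 : fsup d)
    (f : laxhom H1 H2) (g : suphom (tensor J H1) (tensor J H2)) : Prop :=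
  g \o nj J H1 =1 nj J H2 \o pointwise J f.

Record category := Category {
  obj :> Type;
  hom : obj -> obj -> Type;
  idm : forall a, hom a a;
  compm : forall a b c, hom b c -> hom a b -> hom a c;
  comp1m : forall a b (f : hom a b), compm (idm b) f = f;
  compm1 : forall a b (f : hom a b), compm f (idm a) = f;
  compmA : forall a b c e (h : hom c e) (g : hom b c) (f : hom a b),
    compm h (compm g f) = compm (compm h g) f
}.

Record is_functor (C D : category) (F0 : C -> D)
    (F1 : forall a b : C, hom a b -> hom (F0 a) (F0 b)) : Prop := IsFunctor {
  functor_id : forall a : C, F1 a a (idm a) = idm (F0 a);
  functor_comp : forall (a b c : C) (g : hom b c) (f : hom a b),
    F1 a c (compm g f) = compm (F1 b c g) (F1 a b f)
}.

Section Categories.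
Context (d : Order.disp_t).

Lemma suphom_ext (G K : supSemilatticeType d) (f g : suphom G K) :
  f =1 g -> f = g.
Proof.
case: f g => [f fP] [g gP] /= /funext fg; case: _ / fg in gP *.
by congr Suphom; exact: Prop_irrelevance.
Qed.

Lemma suphom_id_subproof (G : supSemilatticeType d) (A : set G) :
  id (sjoin A) = sjoin [set id x | x in A].
Proof. by rewrite image_id. Qed.

Definition suphom_id (G : supSemilatticeType d) : suphom G G :=
  Suphom (@suphom_id_subproof G).

Lemma suphom_comp_subproof (G K L : supSemilatticeType d)
    (g : suphom K L) (f : suphom G K) (A : set G) :
  (g \o f) (sjoin A) = sjoin [set (g \o f) x | x in A].
Proof. by rewrite /= !suphomP image_comp. Qed.

Definition suphom_comp (G K L : supSemilatticeType d)
    (g : suphom K L) (f : suphom G K) : suphom G L :=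
  Suphom (suphom_comp_subproof g f).

Definition sup_cat : category.
Proof.
by apply: (@Category (supSemilatticeType d) (fun G K => suphom G K)
             suphom_id suphom_comp) => *; exact: suphom_ext.
Defined.

Lemma laxhom_ext (H1 H2 : fsup d) (f g : laxhom H1 H2) : f =1 g -> f = g.
Proof.
case: f g => [f fP] [g gP] /= /suphom_ext fg; case: _ / fg in gP *.
by congr Laxhom; exact: Prop_irrelevance.
Qed.

Definition laxhom_id (H : fsup d) : laxhom H H :=
  @Laxhom d H H (suphom_id H) (fun=> lexx _).

Lemma suphom_homo (G K : supSemilatticeType d) (f : suphom G K) (x y : G) :
  x <= y -> f x <= f y.
Proof.
move=> xy; have -> : y = sjoin [set x; y].
  apply/eqP; rewrite eq_le sjoin_ub ?sjoin_le//; last by right.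
  by move=> _ [->|->].
by rewrite suphomP; apply: sjoin_ub; exists x => //; left.
Qed.

Lemma laxhom_comp_subproof (H1 H2 H3 : fsup d)
    (g : laxhom H2 H3) (f : laxhom H1 H2) (x : H1) :
  fop H3 (suphom_comp g f x) <= suphom_comp g f (fop H1 x).
Proof.
by apply: (le_trans (laxhomP g _)); apply: suphom_homo; exact: laxhomP.
Qed.

Definition laxhom_comp (H1 H2 H3 : fsup d)
    (g : laxhom H2 H3) (f : laxhom H1 H2) : laxhom H1 H3 :=
  Laxhom (laxhom_comp_subproof g f).

Definition fsup_cat : category.
Proof.
by apply: (@Category (fsup d) (fun H1 H2 => laxhom H1 H2)
             laxhom_id laxhom_comp) => *; exact: laxhom_ext.
Defined.

End Categories.

(* Main.v *)
(** A map [y] is fixed by [jmap] iff [F x <= y i] implies [x <= y k] for all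
    [i S k].  If [f] is lax with right adjoint [f*], then [f* \o y] is fixed
    whenever [y] is: [F1 x <= f* (y i)] gives [F2 (f x) <= f (F1 x) <= y i],
    hence [f x <= y k].  So [f^J a <= y] implies [f^J (nj a) <= y] for fixed [y],
    that is [nj (f^J (nj a)) = nj (f^J a)].  Hence [t |-> nj (f^J t)] makes the
    square commute, and preserves joins; it is the only such map because [nj] is
    surjective, and functoriality follows from the same identity. *)
Require Import Defs.
From mathcomp Require Import all_boot all_order all_classical.

Set Implicit Arguments.
Unset Strict Implicit.
Unset Printing Implicit Defensive.

Import Order.TTheory.
Local Open Scope classical_set_scope.
Local Open Scope order_scope.

Section SupSemilatticeTheory.
Context (d : Order.disp_t).
Implicit Types G K : supSemilatticeType d.

Lemma sbot_le G (a : G) : sbot <= a.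
Proof. exact: sjoin_le. Qed.

Lemma sjoin2_leP G (a b c : G) : sjoin2 a b <= c <-> a <= c /\ b <= c.
Proof.
split=> [abc|[ac bc]]; last by apply: sjoin_le => _ [->|->].
by split; apply: le_trans abc; apply: sjoin_ub; [left|right].
Qed.

Definition right_adjoint G K (f : suphom G K) (y : K) : G :=
  sjoin [set x | f x <= y].

(** Preservation of joins gives the forward direction: [f (right_adjoint f y)] is a join of elements
    below [y]. *)
Lemma right_adjointP G K (f : suphom G K) x y :
  x <= right_adjoint f y <-> f x <= y.
Proof.
split=> [xy|fxy]; last exact: sjoin_ub.
apply: le_trans (suphom_homo f xy) _; rewrite suphomP.
by apply: sjoin_le => _ [z fzy <-].
Qed.

Lemma pointwise_sjoin T G K (f : suphom G K) (A : set (T -> G)) :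
  pointwise T f (sjoin A) = sjoin [set pointwise T f a | a in A].
Proof.
apply/funext => i; rewrite /pointwise suphomP image_comp.
(* Joins of maps are pointwise by definition, so this holds by conversion. *)
by rewrite [RHS](_ : _ = sjoin [set b i | b in
  [set pointwise T f a | a in A]])// image_comp.
Qed.

End SupSemilatticeTheory.

Section TensorTheory.
Context (d : Order.disp_t) (J : frame).
Implicit Types H : fsup d.

Lemma at_eq_leP H (x : H) (i : J) (a : J -> H) : at_eq x i <= a <-> x <= a i.
Proof.
split=> [/lefP/(_ i)|xa]; first by rewrite /at_eq asboolT.
by apply/lefP => k; rewrite /at_eq; case: asboolP => [->//|_]; exact: sbot_le.
Qed.

Lemma at_rel_leP H (x : H) (i : J) (a : J -> H) :
  at_rel x i <= a <-> (forall k, frame_rel i k -> x <= a k).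
Proof.
split=> [/lefP xa k ik|xa]; first by have := xa k; rewrite /at_rel asboolT.
by apply/lefP => k; rewrite /at_rel; case: asboolP => [/xa//|_]; exact: sbot_le.
Qed.

(** In each pair of [tensor_rel] the second component lies below the first, so only the passage from
    second to first can enlarge [a]. *)
Lemma jmap_fixedP H (a : J -> H) :
  jmap a = a <->
  (forall x i, fop H x <= a i -> forall k, frame_rel i k -> x <= a k).
Proof.
split=> [ja x i /at_eq_leP Fxa|aP].
  apply/at_rel_leP; suff: sjoin2 (at_rel x i) (at_eq (fop H x) i) <= a.
    by case/sjoin2_leP.
  have /sjoin2_leP[_] : jmap a <= a by rewrite ja.
  apply: le_trans; apply: sjoin_ub; exists (at_eq (fop H x) i) => //.
  by left; exists x, i.
apply/eqP; rewrite eq_le le_jmap andbT; apply/sjoin2_leP; split => //.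
apply: sjoin_le => c [b ba] [] [x [i [cE bE]]].
  move: ba; rewrite cE bE => Fxa; apply/sjoin2_leP; split => //.
  by apply/at_rel_leP; apply: aP; exact/at_eq_leP.
(* Reversed pair: [c] is now the smaller component, below [b]. *)
by move: ba; rewrite bE cE => /sjoin2_leP[].
Qed.

Lemma jmap_tensor H (t : tensor J H) : jmap t = t.
Proof. by apply/eqP; case: t. Qed.

(** This exhibits [nj] as left adjoint to the inclusion of the fixed points. *)
Lemma nj_leP H (a : J -> H) (t : tensor J H) : nj J H a <= t <-> a <= t.
Proof.
rewrite -Order.le_val /=; split.
  by apply: le_trans; apply: smeet_ge => x [].
by move=> at_; apply: smeet_lb; split => //; exact: jmap_tensor.
Qed.

Lemma eq_njP H (a b : J -> H) :
  (forall t : tensor J H, a <= t <-> b <= t) -> nj J H a = nj J H b.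
Proof.
(* Each closure serves as the [t] against which the other is tested. *)
by move=> ab; apply/eqP; rewrite eq_le; apply/andP; split;
  apply/nj_leP/ab/nj_leP.
Qed.

Lemma njK H (t : tensor J H) : nj J H t = t.
Proof.
apply/eqP; rewrite eq_le; apply/andP; split; first exact/nj_leP.
by rewrite -Order.le_val; apply/nj_leP.
Qed.

(** Left adjoints preserve joins. *)
Lemma nj_sjoin H (A : set (J -> H)) :
  nj J H (sjoin A) = sjoin [set nj J H a | a in A].
Proof.
apply: eq_njP => t; split=> At.
  apply: sjoin_le => _ [_ [a Aa <-] <-]; rewrite Order.le_val.
  by apply/nj_leP; apply: le_trans At; exact: sjoin_ub.
apply: sjoin_le => a Aa; apply/nj_leP; rewrite -Order.le_val.
by apply: le_trans At; apply: sjoin_ub; exists (nj J H a) => //; exists a.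
Qed.

Lemma right_adjoint_fixed H1 H2 (f : laxhom H1 H2) (t : tensor J H2) :
  jmap (fun i => right_adjoint f (t i)) = (fun i => right_adjoint f (t i)).
Proof.
apply/jmap_fixedP => x i /right_adjointP fFx k ik; apply/right_adjointP.
have /jmap_fixedP := jmap_tensor t; apply; last exact: ik.
exact: le_trans (laxhomP f x) fFx.
Qed.

Lemma pointwise_leP H1 H2 (f : laxhom H1 H2) (a : J -> H1) (b : J -> H2) :
  pointwise J f a <= b <-> a <= (fun i => right_adjoint f (b i)).
Proof.
by split=> /lefP ab; apply/lefP => i; apply/right_adjointP; exact: ab.
Qed.

Lemma nj_pointwise_nj H1 H2 (f : laxhom H1 H2) (a : J -> H1) :
  nj J H2 (pointwise J f (nj J H1 a)) = nj J H2 (pointwise J f a).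
Proof.
apply: eq_njP => t.
(* The transpose of [t] under the pointwise adjunction is a fixed point, so [a] lies below it iff
   its closure does. *)
pose u : tensor J H1 := Tensor (introT eqP (right_adjoint_fixed f t)).
have nau : nj J H1 a <= (u : J -> H1) :> (J -> H1) <-> a <= (u : J -> H1).
  by rewrite Order.le_val; exact: nj_leP.
by split=> /pointwise_leP au; apply/pointwise_leP; exact/nau.
Qed.

Definition tensor_fun H1 H2 (f : laxhom H1 H2) (t : tensor J H1) :
  tensor J H2 := nj J H2 (pointwise J f t).

Lemma tensor_fun_sjoin H1 H2 (f : laxhom H1 H2) (M : set (tensor J H1)) :
  tensor_fun f (sjoin M) = sjoin [set tensor_fun f t | t in M].
Proof.
(* The join of [M] is by definition the closure of a join of maps; the outer [nj] absorbs that
   closure. *)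
rewrite /tensor_fun [sjoin M]/(nj J H1 _) nj_pointwise_nj pointwise_sjoin.
by rewrite nj_sjoin !image_comp.
Qed.

Definition tensor_map H1 H2 (f : laxhom H1 H2) :
  suphom (tensor J H1) (tensor J H2) := Suphom (tensor_fun_sjoin f).

Lemma tensor_map_square H1 H2 (f : laxhom H1 H2) :
  tensor_square f (tensor_map f).
Proof. by move=> a; exact: nj_pointwise_nj. Qed.

Lemma tensor_square_unique H1 H2 (f : laxhom H1 H2)
    (g : suphom (tensor J H1) (tensor J H2)) :
  tensor_square f g -> tensor_map f = g.
Proof.
by move=> gP; apply: suphom_ext => t; rewrite -[in RHS](njK t); apply/esym/gP.
Qed.

End TensorTheory.

Theorem theorem3p7 (d : Order.disp_t) (J : frame) :
  (forall (H1 H2 : fsup d) (f : laxhom H1 H2),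
     exists! g : suphom (tensor J H1) (tensor J H2), tensor_square f g) /\
  (exists Jt : forall H1 H2 : fsup d,
       laxhom H1 H2 -> suphom (tensor J H1) (tensor J H2),
     (forall (H1 H2 : fsup d) (f : laxhom H1 H2), tensor_square f (Jt H1 H2 f)) /\
     @is_functor (fsup_cat d) (sup_cat d) (fun H : fsup d => tensor J H) Jt).
Proof.
split=> [H1 H2 f|].
  exists (tensor_map J f); split; first exact: tensor_map_square.
  exact: tensor_square_unique.
exists (fun H1 H2 f => tensor_map J f); split; first exact: tensor_map_square.
split=> [H|H1 H2 H3 g f]; first by apply: suphom_ext => t; exact: njK.
(* The composite closes once more between [f] and [g], and the outer [nj] absorbs this closure. *)
by apply: suphom_ext => t; apply/esym; exact: nj_pointwise_nj.
Qed.
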